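(* Two cographs are isomorphic if and only if they are quantum isomorphic.
   Context: Graphs are finite, simple and undirected, with at least one vertex. The class of cographs is the smallest class of graphs containing the one-vertex graph $K_1$ and stable under finite disjoint unions and complement. Unital $C^*$-algebras are assumed nonzero. A magic unitary with coefficients in a unital $C^*$-algebra $X$ is a square matrix with entries in $X$ that are self-adjoint projections such that each row and each column sums to $1_X$. Two graphs $G$ and $H$ with the same number of vertices are quantum isomorphic if there exist a unital $C^*$-algebra $X$ and a magic unitary $U$ with coefficients in $X$, rows indexed by $V(H)$ and columns by $V(G)$, such that $U\,\mathrm{Adj}(G)=\mathrm{Adj}(H)\,U$, where $\mathrm{Adj}$ denotes the adjacency matrix. *)

(* Defs.v *)
From HB Require Import structures.
From mathcomp Require Import all_boot all_order all_algebra.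
From mathcomp Require Import all_classical all_reals all_analysis.
From mathcomp Require Import complex.

Set Implicit Arguments.
Unset Strict Implicit.
Unset Printing Implicit Defensive.

Import Order.TTheory GRing.Theory Num.Theory.
Import numFieldNormedType.Exports.

Local Open Scope ring_scope.

Record sgraph := SGraph {
  vertex :> finType;
  edge : rel vertex;
  edge_sym : symmetric edge;
  edge_irr : irreflexive edge;
  vertex_gt0 : (0 < #|vertex|)%N }.

Definition graph_isomorphic (G H : sgraph) : Prop :=
  exists2 f : G -> H, bijective f & {mono f : x y / edge x y}.

Fact K1_edge_sym : symmetric (fun _ _ : unit => false).
Proof. by []. Qed.

Fact K1_edge_irr : irreflexive (fun _ _ : unit => false).
Proof. by []. Qed.

Fact K1_gt0 : (0 < #|{: unit}|)%N.
Proof. by rewrite card_unit. Qed.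

Definition K1 : sgraph := SGraph K1_edge_sym K1_edge_irr K1_gt0.

Section Complement.
Variable G : sgraph.

Definition compl_edge : rel G := fun x y => (x != y) && ~~ edge x y.

Fact compl_edge_sym : symmetric compl_edge.
Proof. by move=> x y; rewrite /compl_edge eq_sym edge_sym. Qed.

Fact compl_edge_irr : irreflexive compl_edge.
Proof. by move=> x; rewrite /compl_edge eqxx. Qed.

Definition compl_graph : sgraph :=
  SGraph compl_edge_sym compl_edge_irr (vertex_gt0 G).

End Complement.

Section DisjointUnion.
Variables (I : finType) (F : I -> sgraph).

(* [tagged_as u v] is the second component of [v] seen in the fibre of [u];
   it is meaningful only under the guard [tag u == tag v]. *)
Definition dunion_edge : rel {i : I & F i} :=
  fun u v => (tag u == tag v) && edge (tagged u) (tagged_as u v).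

Fact dunion_edge_sym : symmetric dunion_edge.
Proof.
move=> [i x] [j y]; rewrite /dunion_edge /= [j == i]eq_sym.
by case: eqP => //= eij; case: j / eij y => y; rewrite !tagged_asE edge_sym.
Qed.

Fact dunion_edge_irr : irreflexive dunion_edge.
Proof. by move=> [i x]; rewrite /dunion_edge eqxx tagged_asE edge_irr. Qed.

Hypothesis I_gt0 : (0 < #|I|)%N.

Fact dunion_gt0 : (0 < #|{: {i : I & F i}}|)%N.
Proof.
have /card_gt0P[i _] := I_gt0; have /card_gt0P[x _] := vertex_gt0 (F i).
by apply/card_gt0P; exists (Tagged (fun i => F i) x).
Qed.

Definition dunion : sgraph :=
  SGraph dunion_edge_sym dunion_edge_irr dunion_gt0.

End DisjointUnion.

(* Classes of graphs are understood up to isomorphism, hence [cograph_iso].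
   Unions are over nonempty families because graphs have a vertex. *)
Inductive cograph : sgraph -> Prop :=
| cograph_iso (G H : sgraph) : graph_isomorphic G H -> cograph G -> cograph H
| cograph_K1 : cograph K1
| cograph_dunion (I : finType) (F : I -> sgraph) (I_gt0 : (0 < #|I|)%N) :
    (forall i, cograph (F i)) -> cograph (dunion F I_gt0)
| cograph_compl (G : sgraph) : cograph G -> cograph (compl_graph G).

(* [GRing.Algebra] algebras are unital with [1 != 0]. MathComp-Analysis has no
   normed algebras, and [CompleteNormedModule] cannot be joined with a ring
   structure other than a [numDomainType] (Hierarchy Builder rejects the join),
   so the complete norm is part of the mixin. [Normc.normc] is the [R]-valued modulus
   on [R[i]], and [a^*] is complex conjugation. *)
HB.mixin Record Algebra_isCstar (R : realType) (A : Type)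
    of GRing.Algebra R[i] A := {
  star : A -> A;
  cnorm : A -> R;
  starK : involutive star;
  starD : {morph star : x y / x + y};
  starZ : forall (a : R[i]) (x : A), star (a *: x) = a^* *: star x;
  starM : forall x y : A, star (x * y) = star y * star x;
  cnorm0_eq0 : forall x : A, cnorm x = 0 -> x = 0;
  ler_cnormD : forall x y : A, cnorm (x + y) <= cnorm x + cnorm y;
  cnormZ : forall (a : R[i]) (x : A), cnorm (a *: x) = Normc.normc a * cnorm x;
  ler_cnormM : forall x y : A, cnorm (x * y) <= cnorm x * cnorm y;
  cnorm_complete : forall u : nat -> A,
    (forall e : R, 0 < e ->
       exists N, forall m n, (N <= m)%N -> (N <= n)%N -> cnorm (u m - u n) < e) ->
    exists l : A, forall e : R, 0 < e ->
      exists N, forall n, (N <= n)%N -> cnorm (u n - l) < e;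
  cnorm_star_mul : forall x : A, cnorm (star x * x) = cnorm x ^+ 2 }.

#[short(type="cstarAlgType")]
HB.structure Definition CstarAlgebra (R : realType) :=
  {A of GRing.Algebra R[i] A & Algebra_isCstar R A}.

Definition is_projection (R : realType) (X : cstarAlgType R) (p : X) : Prop :=
  star p = p /\ p * p = p.

(* The index sets of a magic unitary may be two enumerated vertex sets, so its
   squareness is kept as the equation [m = n]. *)
Definition magic_unitary (R : realType) (X : cstarAlgType R) (m n : nat)
    (U : 'M[X]_(m, n)) : Prop :=
  [/\ m = n,
      forall i j, is_projection (U i j),
      forall i, \sum_j U i j = 1
    & forall j, \sum_i U i j = 1].

(* Vertices are numbered by [enum_val : 'I_#|G| -> G]. *)
Definition adjacency_mx (R : nzRingType) (G : sgraph) : 'M[R]_#|G| :=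
  \matrix_(i, j) (edge (enum_val i) (enum_val j))%:R.

Definition quantum_isomorphic (R : realType) (G H : sgraph) : Prop :=
  #|G| = #|H| /\
  exists (X : cstarAlgType R) (U : 'M[X]_(#|H|, #|G|)),
    magic_unitary U /\ U *m adjacency_mx X G = adjacency_mx X H *m U.

(* Main.v *)
(* Cut the graph G along connected components of G or of its complement. A magic
   unitary u intertwining the adjacency matrices satisfies u_hg u_h'g' = 0
   unless (h, h') and (g, g') are related in the same way (equal, adjacent),
   hence also unless h, h' are connected exactly when g, g' are. So for a
   component C of G and D of H, the sum of u_hg over g in C does not depend on
   h in D, and equals the sum of u_hg over h in D for any g in C. If it is a
   nonzero q, then the block of u on D x C is a magic unitary over the corner
   with unit q, and C is isomorphic to D by induction on the size. Summing the
   entries of u over the vertices whose component has a given isomorphism type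
   shows that each type occurs equally often in G and H.

   Orthogonality of projections summing to 1 is derived without spectral theory
   from the fact that a unit is an extreme point of the unit ball. *)

From HB Require Import structures.
Require Import Defs.
From mathcomp Require Import all_classical all_reals all_analysis.
From mathcomp Require Import all_boot all_order all_algebra.
From mathcomp Require Import complex ring lra.

Set Implicit Arguments.
Unset Strict Implicit.
Unset Printing Implicit Defensive.

Import Order.TTheory GRing.Theory Num.Theory.
Import numFieldNormedType.Exports.

Local Open Scope ring_scope.

(** * Projections in a C*-algebra *)

Lemma normc_real (R : rcfType) (r : R) : Normc.normc r%:C%C = `|r|.
Proof. by rewrite /Normc.normc /= expr0n addr0 sqrtr_sqr. Qed.

Section CstarNorm.
Variables (R : realType) (X : cstarAlgType R).
Implicit Types (x y p q k : X) (r : R).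

Lemma cnormZr r x : cnorm (r%:C%C *: x) = `|r| * cnorm x.
Proof. by rewrite cnormZ normc_real. Qed.

Lemma mulrn_realZ x n : x *+ n = (n%:R : R)%:C%C *: x.
Proof. by rewrite -scaler_nat -(rmorph_nat (real_complex R)). Qed.

Lemma cnormMn x n : cnorm (x *+ n) = n%:R * cnorm x.
Proof. by rewrite mulrn_realZ cnormZr normr_nat. Qed.

Lemma cnorm0 : cnorm (0 : X) = 0.
Proof. by rewrite -(scale0r 0) cnormZ Normc.normc0 mul0r. Qed.

Lemma cnormN x : cnorm (- x) = cnorm x.
Proof.
have /= := cnormZr (-1) x.
by rewrite rmorphN rmorph1 scaleN1r normrN normr1 mul1r.
Qed.

Lemma cnorm_ge0 x : 0 <= cnorm x.
Proof.
have := ler_cnormD x (- x).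
by rewrite subrr cnorm0 cnormN -mulr2n pmulrn_lge0.
Qed.

Lemma star_mul_eq0 x : star x * x = 0 -> x = 0.
Proof.
move=> xx0; apply: cnorm0_eq0; apply/eqP.
by rewrite -sqrf_eq0 -cnorm_star_mul xx0 cnorm0.
Qed.

Lemma starB : {morph (@star R X) : x y / x - y}.
Proof. by move=> x y; rewrite starD -scaleN1r starZ rmorphN1 scaleN1r. Qed.

Lemma star0 : star 0 = 0 :> X.
Proof. by rewrite -(subrr 0) starB !subrr. Qed.

Lemma star1 : star 1 = 1 :> X.
Proof.
by have := congr1 star (mulr1 (star (1 : X))); rewrite starM !starK mulr1 => ->.
Qed.

Lemma cnorm_proj p : is_projection p -> cnorm p <= 1.
Proof.
move=> [sp pp]; have := cnorm_star_mul p; rewrite sp pp expr2 => e.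
have [->|p0] := eqVneq (cnorm p) 0; first exact: ler01.
by rewrite -(mulfI p0 (etrans (mulr1 _) e)).
Qed.

Lemma is_projectionC p : is_projection p -> is_projection (1 - p).
Proof.
move=> [sp pp]; split; first by rewrite starB star1 sp.
by rewrite mulrBl mul1r mulrBr mulr1 pp subrr subr0.
Qed.

(** On expansion [k * x] and [p] cancel. The factors [p + k] and [p - k] are the two contractions of
    the induction that follows. *)
Lemma walk_step p k x : p * p = p -> k * p = k -> p * x = x ->
  (p + k) * (x + p) + (p - k) * (x - p) = (x + k) *+ 2.
Proof.
move=> pp kp px; rewrite !mulrDl !mulrDr !mulNr !mulrN px pp kp opprK.
rewrite addrACA [x + p + _]addrACA [k * x + k + _]addrACA !addrN add0r addr0.
by rewrite -!mulr2n mulrnDl.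
Qed.

(* [walk_step] writes [c p + (n + 1) k] as a mean of two contractions applied
   to [(c + 1) p + n k] and [(c - 1) p + n k]. Hence [c p + n k] has norm at most
   the mean of [|c + W|] for a simple random walk [W] of length [n], which is of
   order [sqrt n] for fixed [c]; the bound comes from
   [|y| <= (y^2 + t^2) / (2 t)]. *)
Lemma cnorm_walk p k (t : R) (n : nat) (c : R) :
  p * p = p -> p * k = k -> k * p = k ->
  cnorm p <= 1 -> cnorm (p + k) <= 1 -> cnorm (p - k) <= 1 -> 0 < t ->
  cnorm (c%:C%C *: p + k *+ n) <= (c ^+ 2 + n%:R + t ^+ 2) / (2 * t).
Proof.
move=> pp pk kp p1 hD hB t0; elim: n c => [|n IHn] c.
  rewrite mulr0n !addr0 cnormZr.
  apply: (@le_trans _ _ `|c|); first by rewrite ler_piMr.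
  rewrite ler_pdivlMr ?mulr_gt0//.
  rewrite -subr_ge0 (_ : _ - _ = (`|c| - t) ^+ 2) ?sqr_ge0//.
  by rewrite -(real_normK (num_real c)); ring.
set x := c%:C%C *: p + k *+ n.
have px : p * x = x by rewrite mulrDr -scalerAr pp mulrnAr pk.
have IHB : cnorm (x + p) <= ((c + 1) ^+ 2 + n%:R + t ^+ 2) / (2 * t).
  by have := IHn (c + 1); rewrite rmorphD rmorph1 scalerDl scale1r addrAC.
have IHD : cnorm (x - p) <= ((c - 1) ^+ 2 + n%:R + t ^+ 2) / (2 * t).
  by have := IHn (c - 1); rewrite rmorphB rmorph1 scalerBl scale1r addrAC.
have -> : c%:C%C *: p + k *+ n.+1 =
          (2^-1)%:C%C *: ((p + k) * (x + p) + (p - k) * (x - p)).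
  rewrite walk_step//.
  rewrite (mulrn_realZ (x + k)) scalerA -rmorphM mulVf ?pnatr_eq0//.
  by rewrite rmorph1 scale1r mulrSr addrA.
rewrite cnormZr gtr0_norm ?invr_gt0//.
rewrite mulrC ler_pdivrMr//; apply: le_trans (ler_cnormD _ _) _.
have le_mul y z : cnorm y <= 1 -> cnorm (y * z) <= cnorm z.
  by move=> y1; apply: le_trans (ler_cnormM _ _) _; rewrite ler_piMl ?cnorm_ge0.
apply: le_trans (lerD (le_mul _ _ hD) (le_mul _ _ hB)) _.
apply: le_trans (lerD IHB IHD) _.
(* The mean of [(c + 1) ^+ 2] and [(c - 1) ^+ 2] is [c ^+ 2 + 1], which accounts for the extra step
   of the walk. *)
rewrite -mulrDl mulrAC ler_pM2r ?invr_gt0 ?mulr_gt0//.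
by rewrite -natr1; lra.
Qed.

(* [p] is an extreme point of the unit ball of the corner [p X p]. *)
Lemma cnorm_extreme p k :
  p * p = p -> p * k = k -> k * p = k ->
  cnorm p <= 1 -> cnorm (p + k) <= 1 -> cnorm (p - k) <= 1 -> k = 0.
Proof.
move=> pp pk kp p1 hD hB; apply: cnorm0_eq0.
apply/eqP; rewrite eq_le cnorm_ge0 andbT leNgt; apply/negP => k0.
have [m hm] : exists m : nat, 1 < m%:R * cnorm k.
  exists (Num.bound (cnorm k)^-1).
  by rewrite -ltr_pdivrMr// div1r archi_boundP// invr_ge0 ltW.
have m0 : (0 < m%:R :> R).
  by rewrite ltr0n lt0n; apply: contraTneq hm => ->; rewrite mul0r ltr10.
(* A walk of [m ^ 2] steps from [c = 0], with [t = m], gives [m ^ 2 * cnorm k <= m], against the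
   choice of [m]. *)
have := cnorm_walk (m ^ 2) 0 pp pk kp p1 hD hB m0.
rewrite rmorph0 scale0r add0r cnormMn !natrX expr0n add0r.
rewrite ler_pdivlMr ?mulr_gt0//; apply/negP; rewrite -ltNge.
have /= := ltr_pM2l (exprn_gt0 2 m0) 1 (m%:R * cnorm k).
by rewrite hm mulr1 => h; lra.
Qed.

Lemma cnorm_sum (I : finType) (P : pred I) (F : I -> X) :
  (forall i, P i -> cnorm (F i) <= 1) ->
  cnorm (\sum_(i | P i) F i) <= #|P|%:R.
Proof.
move=> F1; rewrite -sum1_card natr_sum.
elim/big_ind2: _ => [|x r y s xr ys|i /F1//]; first by rewrite cnorm0.
exact: le_trans (ler_cnormD _ _) (lerD xr ys).
Qed.

Lemma projections_orthogonal (I : finType) (p : I -> X) (i j : I) :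
  (forall i, is_projection (p i)) -> \sum_i p i = 1 -> i != j ->
  p i * p j = 0.
Proof.
(* The [h l] with [l != i] sum to zero and each [p i - h l] is a contraction, so
   extremality of [p i] gives [h j = (p j p i)^* (p j p i) = 0]. *)
move=> pP sum1 ij; pose h l := p i * p l * p i.
have [sp pp] := pP i; have [sq qq] := pP j.
have ph l : p i * h l = h l by rewrite /h !mulrA pp.
have hp l : h l * p i = h l by rewrite /h -!mulrA pp.
have p1 : cnorm (p i) <= 1 by exact: cnorm_proj.
have h1 l : cnorm (p i - h l) <= 1.
  have -> : p i - h l = p i * (1 - p l) * p i.
    by rewrite mulrBr mulr1 mulrBl pp.
  do 2 (apply: le_trans (ler_cnormM _ _) _; apply: mulr_ile1;
    rewrite ?cnorm_ge0//); exact/cnorm_proj/is_projectionC.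
have sumh : \sum_(l | (l != i) && (l != j)) h l = - h j.
  have : \sum_l h l = p i by rewrite -mulr_suml -mulr_sumr sum1 mulr1 pp.
  rewrite (bigD1 i)//= {1}/h pp pp => /(canRL (addKr _)).
  rewrite addNr (bigD1 j) 1?eq_sym//=.
  by move/(canRL (addKr _)); rewrite addr0.
pose A := [pred l | (l != i) && (l != j)].
(* This divisor makes [p i + k] the mean of [p i] and the [p i - h l] with [l] in [A], and [p i - k]
   the mean of [#|A|] copies of [p i] and one [p i - h j]. *)
pose k := (#|A|.+1%:R^-1 : R)%:C%C *: h j.
have scale (x y : X) :
    y = x *+ #|A|.+1 -> cnorm y <= #|A|.+1%:R -> cnorm x <= 1.
  by move=> ->; rewrite cnormMn ger_pMr ?ltr0n.
have kn : k *+ #|A|.+1 = h j.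
  by rewrite mulrn_realZ scalerA -rmorphM mulfV ?pnatr_eq0// rmorph1 scale1r.
have k0 : k = 0.
  apply: (@cnorm_extreme _ k pp); rewrite ?p1//.
  - by rewrite -scalerAr ph.
  - by rewrite -scalerAl hp.
  - apply: (scale _ (p i + \sum_(l in A) (p i - h l))).
      by rewrite sumrB sumh opprK sumr_const mulrnDl kn mulrS addrA.
    rewrite -natr1 addrC; apply: le_trans (ler_cnormD _ _) _.
    by apply: lerD => //; exact: cnorm_sum.
  - apply: (scale _ (p i *+ #|A| + (p i - h j))).
      by rewrite mulrnBl kn mulrSr addrA.
    rewrite -natr1; apply: le_trans (ler_cnormD _ _) _.
    by apply: lerD => //; rewrite cnormMn ler_piMr.
have h0 : h j = 0 by rewrite -kn k0 mul0rn.
have qp0 : p j * p i = 0.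
  apply: star_mul_eq0; rewrite starM sp sq mulrA -[_ * p j]mulrA qq.
  exact: h0.
have sstar (x y : X) : x * y = 0 -> star y * star x = 0.
  by move=> xy0; rewrite -starM xy0 star0.
by rewrite -[p i]sp -[p j]sq; exact: sstar.
Qed.

End CstarNorm.

(** * Isomorphisms between induced subgraphs *)

(** Isomorphism of induced subgraphs. The map is total on [V], which avoids subtypes; its values
    outside [S] are arbitrary. *)
Definition set_iso (V W : finType) (e : rel V) (e' : rel W)
    (S : {set V}) (T : {set W}) : Prop :=
  exists f : V -> W, [/\ {in S &, injective f}, f @: S = T
    & {in S &, forall x y, e' (f x) (f y) = e x y}].

Definition cpl (V : eqType) (e : rel V) : rel V :=
  fun x y => (x != y) && ~~ e x y.

(** Still a relation on all of [V]: under [connect], each vertex outside [S] forms a class by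
    itself. *)
Definition restr (V : finType) (S : {set V}) (e : rel V) : rel V :=
  [rel x y | [&& x \in S, y \in S & e x y]].

Definition cls (V : finType) (r : rel V) (x : V) : {set V} := [set y | r x y].

Definition rclosed (V : finType) (r : rel V) (S : {set V}) : Prop :=
  forall x y, x \in S -> r x y -> y \in S.

Lemma cplK (V : finType) (e : rel V) : irreflexive e -> cpl (cpl e) =2 e.
Proof.
by move=> ei x y; rewrite /cpl; case: eqVneq => [->|_] //=; rewrite negbK.
Qed.

Lemma cpl_sym (V : finType) (e : rel V) : symmetric e -> symmetric (cpl e).
Proof. by move=> es x y; rewrite /cpl eq_sym es. Qed.

Lemma set_iso_trans (U V W : finType) (e1 : rel U) (e2 : rel V) (e3 : rel W)
    (A : {set U}) (B : {set V}) (C : {set W}) :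
  set_iso e1 e2 A B -> set_iso e2 e3 B C -> set_iso e1 e3 A C.
Proof.
move=> [f [fi fA fe]] [g [gi gB ge]].
have fin x : x \in A -> f x \in B by move=> xA; rewrite -fA imset_f.
exists (g \o f); split.
- by move=> x y xA yA /= /gi/fi; apply => //; apply: fin.
- by rewrite imset_comp fA.
- by move=> x y xA yA /=; rewrite ge ?fin// fe.
Qed.

Lemma set_iso_sym (V W : finType) (e : rel V) (e' : rel W) (v : V)
    (A : {set V}) (B : {set W}) :
  set_iso e e' A B -> set_iso e' e B A.
Proof.
move=> [f [fi fA fe]].
(* The inverse of [f] on [B]; [v] is the default value outside [B]. *)
pose g w := odflt v [pick x in A | f x == w].
have fK : {in A, cancel f g}.
  move=> x xA; rewrite /g; case: pickP => [y /andP[yA /eqP/fi]|/(_ x)].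
    exact.
  by rewrite xA eqxx.
have gP w : w \in B -> exists2 x, x \in A & w = f x.
  by rewrite -fA => /imsetP[x xA ->]; exists x.
exists g; split.
- by move=> _ _ /gP[x xA ->] /gP[y yA ->]; rewrite !fK// => ->.
- rewrite -fA -imset_comp; apply/setP => x; apply/imsetP/idP => [[y yA ->]|xA].
    by rewrite /= fK.
  by exists x; rewrite //= fK.
- by move=> _ _ /gP[x xA ->] /gP[y yA ->]; rewrite !fK// fe.
Qed.

Lemma set_iso_cpl (V W : finType) (e : rel V) (e' : rel W)
    (A : {set V}) (B : {set W}) :
  set_iso e e' A B -> set_iso (cpl e) (cpl e') A B.
Proof.
move=> [f [fi fA fe]]; exists f; split=> // x y xA yA.
by rewrite /cpl fe// (inj_in_eq fi).
Qed.

Lemma eq_set_iso (V W : finType) (e1 e2 : rel V) (e1' e2' : rel W)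
    (A : {set V}) (B : {set W}) :
  e1 =2 e2 -> e1' =2 e2' -> set_iso e1 e1' A B -> set_iso e2 e2' A B.
Proof.
move=> E E' [f [fi fA fe]]; exists f; split=> // x y xA yA.
by rewrite -E -E' fe.
Qed.

Lemma set_isoU (V W : finType) (e : rel V) (e' : rel W)
    (A1 A2 : {set V}) (B1 B2 : {set W}) :
  symmetric e -> symmetric e' -> [disjoint A1 & A2] -> [disjoint B1 & B2] ->
  (forall x y, x \in A1 -> y \in A2 -> ~~ e x y) ->
  (forall x y, x \in B1 -> y \in B2 -> ~~ e' x y) ->
  set_iso e e' A1 B1 -> set_iso e e' A2 B2 ->
  set_iso e e' (A1 :|: A2) (B1 :|: B2).
Proof.
move=> es es' dA dB nA nB [f [fi fA fe]] [g [gi gA ge]].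
pose k x := if x \in A1 then f x else g x.
have kf x : x \in A1 -> k x = f x by rewrite /k => ->.
have kg x : x \in A2 -> k x = g x.
  by rewrite /k; case: ifP => // x1; rewrite (disjointFr dA x1).
have fB x : x \in A1 -> f x \in B1 by move=> xA; rewrite -fA imset_f.
have gB x : x \in A2 -> g x \in B2 by move=> xA; rewrite -gA imset_f.
exists k; split.
- move=> x y /setUP[xA|xA] /setUP[yA|yA]; rewrite ?(kf _ xA) ?(kg _ xA)
    ?(kf _ yA) ?(kg _ yA).
  + exact: fi.
  + by move=> fg; have := disjointFr dB (fB _ xA); rewrite fg gB.
  + by move=> fg; have := disjointFr dB (fB _ yA); rewrite -fg gB.
  + exact: gi.
- rewrite imsetU; congr (_ :|: _).
  + by rewrite -fA; apply: eq_in_imset.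
  + by rewrite -gA; apply: eq_in_imset.
- move=> x y /setUP[xA|xA] /setUP[yA|yA]; rewrite ?(kf _ xA) ?(kg _ xA)
    ?(kf _ yA) ?(kg _ yA).
  + exact: fe.
  + by rewrite (negPf (nA _ _ xA yA)) (negPf (nB _ _ (fB _ xA) (gB _ yA))).
  + rewrite es es' (negPf (nA _ _ yA xA)).
    by rewrite (negPf (nB _ _ (fB _ yA) (gB _ xA))).
  + exact: ge.
Qed.

Lemma mem_cls (V : finType) (r : rel V) (x y : V) : (y \in cls r x) = r x y.
Proof. by rewrite inE. Qed.

Lemma eq_cls (V : finType) (r : rel V) (x y : V) :
  equivalence_rel r -> r x y -> cls r x = cls r y.
Proof.
move=> /equivalence_relP[_ rt] rxy.
by apply/setP => z; rewrite !inE (rt _ _ rxy).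
Qed.

Lemma equivalence_sym (V : finType) (r : rel V) :
  equivalence_rel r -> symmetric r.
Proof.
move=> rE x y; apply/idP/idP => rxy.
  by have [rxx /(_ rxy) <-] := rE x y x.
by have [ryy /(_ rxy) <-] := rE y x y.
Qed.

Lemma equivalence_trans (V : finType) (r : rel V) :
  equivalence_rel r -> transitive r.
Proof. by move=> rE y x z rxy; have [_ /(_ rxy) ->] := rE x y z. Qed.

(* Components with the same isomorphism type have the same size, so counting
   vertices by the isomorphism type of their component counts components. *)
Lemma set_iso_glue (V W : finType) (e r : rel V) (e' r' : rel W) (w : W)
    (S : {set V}) (T : {set W}) :
  symmetric e -> symmetric e' -> equivalence_rel r -> equivalence_rel r' ->
  rclosed r S -> rclosed r' T ->
  {in S &, forall x y, e x y -> r x y} ->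
  {in T &, forall x y, e' x y -> r' x y} ->
  #|S| = #|T| ->
  (forall x, #|[set y in S | `[< set_iso e e (cls r x) (cls r y) >]]| =
             #|[set z in T | `[< set_iso e e' (cls r x) (cls r' z) >]]|) ->
  set_iso e e' S T.
Proof.
move=> es es' rE rE'.
have rs := equivalence_sym rE; have rt := equivalence_trans rE.
have rs' := equivalence_sym rE'; have rt' := equivalence_trans rE'.
have r_refl x : r x x by have [] := rE x x x.
have r_refl' x : r' x x by have [] := rE' x x x.
have [m] := ubnP #|S|; elim: m S T => // m IHm S T; rewrite ltnS => Sm.
move=> rS rT Se Te ST cnt.
have [S0|[x xS]] := set_0Vmem S.
  have T0 : T = set0.
    by apply/eqP; rewrite -cards_eq0 -ST S0 cards0.
  exists (fun=> w); rewrite S0 T0 imset0; split=> //.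
  - by move=> x y; rewrite inE.
  - by move=> x y; rewrite inE.
(* The type of the component of [x] is counted at least once in [S], by [x] itself, hence also in
   [T]. The matched pair of components is then removed. *)
have [z zT xz] : exists2 z, z \in T & set_iso e e' (cls r x) (cls r' z).
  have : (0 < #|[set y in S | `[< set_iso e e (cls r x) (cls r y) >]]|)%N.
    apply/card_gt0P; exists x; rewrite inE xS; apply/asboolP.
    by exists id; split=> //; rewrite imset_id.
  rewrite cnt => /card_gt0P[z]; rewrite inE => /andP[zT /asboolP ?].
  by exists z.
have xsub : cls r x \subset S by apply/subsetP => y; rewrite inE; apply: rS.
have zsub : cls r' z \subset T by apply/subsetP => y; rewrite inE; apply: rT.
have cxz : #|cls r x| = #|cls r' z|.
  by have [f [fi <- _]] := xz; rewrite card_in_imset.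
have cS' : #|S :\: cls r x| = #|T :\: cls r' z|.
  by rewrite !cardsD (setIidPr xsub) (setIidPr zsub) ST cxz.
rewrite -(setID S (cls r x)) -(setID T (cls r' z)).
rewrite (setIidPr xsub) (setIidPr zsub).
have nr y y' : y \in S :\: cls r x -> r y y' -> y' \notin cls r x.
  rewrite !inE => /andP[+ _] ryy'; apply: contra => rxy'.
  by apply: (rt y') => //; rewrite rs.
have nr' y y' : y \in T :\: cls r' z -> r' y y' -> y' \notin cls r' z.
  rewrite !inE => /andP[+ _] ryy'; apply: contra => rxy'.
  by apply: (rt' y') => //; rewrite rs'.
have dis (U : finType) (A B : {set U}) : [disjoint A & B :\: A].
  by rewrite disjoint_sym disjoints_subset subsetDr.
apply: set_isoU => //.
- move=> a b aK bK; apply/negP => /Se eab.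
  have := nr _ a bK; rewrite aK rs => /(_ (eab _ _))/negP; apply=> //.
    exact: (subsetP xsub).
  by case/setDP: bK.
- move=> a b aK bK; apply/negP => /Te eab.
  have := nr' _ a bK; rewrite aK rs' => /(_ (eab _ _))/negP; apply=> //.
    exact: (subsetP zsub).
  by case/setDP: bK.
apply: IHm => //.
- apply: leq_trans Sm; rewrite [ltnRHS](cardsD1 x) xS ltnS.
  by rewrite subset_leq_card// setDS// sub1set inE.
- move=> a b aS rab; rewrite in_setD (nr _ _ aS)//=.
  by apply: rS rab; move: aS; rewrite inE => /andP[].
- move=> a b aS rab; rewrite in_setD (nr' _ _ aS)//=.
  by apply: rT rab; move: aS; rewrite inE => /andP[].
- by move=> a b /setDP[aS _] /setDP[bS _]; apply: Se.
- by move=> a b /setDP[aS _] /setDP[bS _]; apply: Te.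
move=> y; have := cnt y.
set P := [set y0 in S | _]; set Q := [set z0 in T | _].
have -> : [set y0 in S :\: cls r x | `[< set_iso e e (cls r y) (cls r y0) >]] =
          P :\: cls r x.
  by apply/setP => a; rewrite !inE andbA.
have -> : [set z0 in T :\: cls r' z |
            `[< set_iso e e' (cls r y) (cls r' z0) >]] = Q :\: cls r' z.
  by apply/setP => a; rewrite !inE andbA.
rewrite -(cardsID (cls r x) P) -(cardsID (cls r' z) Q).
(* The removed components lie entirely inside the counted sets if they have the type of [y], and
   miss them otherwise, so both counts drop equally. *)
suff -> : #|P :&: cls r x| = #|Q :&: cls r' z| by move/addnI.
have yxz : set_iso e e (cls r y) (cls r x) <->
           set_iso e e' (cls r y) (cls r' z).
  split=> h; first exact: set_iso_trans h xz.
  exact: set_iso_trans h (set_iso_sym x xz).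
have [yx|yx] := pselect (set_iso e e (cls r y) (cls r x)).
  rewrite (setIidPr _) ?(setIidPr _) ?cxz//; apply/subsetP => a.
    rewrite !inE => za; rewrite (rT _ _ zT za); apply/asboolP.
    by rewrite -(eq_cls rE' za); apply/yxz.
  rewrite !inE => xa; rewrite (rS _ _ xS xa); apply/asboolP.
  by rewrite -(eq_cls rE xa).
rewrite (_ : P :&: _ = set0) 1?(_ : Q :&: _ = set0) ?cards0//.
  apply/setP => a; rewrite !inE; apply/negP => /andP[/andP[_ /asboolP +] za].
  by rewrite -(eq_cls rE' za) => /yxz.
apply/setP => a; rewrite !inE; apply/negP => /andP[/andP[_ /asboolP +] xa].
by rewrite -(eq_cls rE xa).
Qed.

(** * Quantum bijections *)

Section QuantumPermutations.
Variable X : pzRingType.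

(** For [eq_op] on both sides this is the orthogonality of distinct entries in a common row or
    column. *)
Definition respects (V W : finType) (S : {set V}) (T : {set W})
    (u : W -> V -> X) (r : rel V) (r' : rel W) : Prop :=
  forall h h' g g', h \in T -> h' \in T -> g \in S -> g' \in S ->
    r g g' != r' h h' -> u h g * u h' g' = 0.

(* A magic unitary over the corner of [X] with unit [p]. *)
Definition quantum_bij (V W : finType) (p : X) (S : {set V}) (T : {set W})
    (u : W -> V -> X) : Prop :=
  [/\ {in T & S, forall h g, p * u h g = u h g /\ u h g * p = u h g},
      {in T, forall h, \sum_(g in S) u h g = p},
      {in S, forall g, \sum_(h in T) u h g = p}
    & respects S T u eq_op eq_op].

Lemma respects_tr (V W : finType) (S : {set V}) (T : {set W}) u r r' :
  respects S T u r r' -> respects T S (fun g h => u h g) r' r.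
Proof. by move=> ru g g' h h' gS g'S hT h'T; rewrite eq_sym; apply: ru. Qed.

Lemma respectsS (V W : finType) (S S' : {set V}) (T T' : {set W}) u r r' :
  S' \subset S -> T' \subset T -> respects S T u r r' -> respects S' T' u r r'.
Proof.
move=> /subsetP sS /subsetP sT ru h h' g g' hT h'T gS g'S; apply: ru;
  by [exact: sS|exact: sT].
Qed.

Lemma respects_cpl (V W : finType) (S : {set V}) (T : {set W}) u e e' :
  respects S T u eq_op eq_op -> respects S T u e e' ->
  respects S T u (cpl e) (cpl e').
Proof.
move=> ue uee h h' g g' hT h'T gS g'S; rewrite /cpl => ne.
have [E|E] := eqVneq (g == g') (h == h'); last exact: ue.
apply: uee => //; apply: contraNneq ne => ->.
by rewrite E.
Qed.

Section Bijection.
Variables (V W : finType) (p : X) (S : {set V}) (T : {set W}).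
Variable u : W -> V -> X.
Hypothesis uP : quantum_bij p S T u.

Lemma quantum_bij_tr : quantum_bij p T S (fun g h => u h g).
Proof.
have [up ur uc ue] := uP; split=> //; last exact: respects_tr.
by move=> g h gS hT; apply: up.
Qed.

(** Multiply [u h g] by [p], written as the sum of row [h]: orthogonality leaves only the square. *)
Lemma quantum_bij_idem : {in T & S, forall h g, u h g * u h g = u h g}.
Proof.
move=> h g hT gS; have [up ur _ ue] := uP.
have [_ up_r] := up h g hT gS.
rewrite -[RHS]up_r -(ur h hT) mulr_sumr (bigD1 g)//=.
rewrite big1 ?addr0// => g' /andP[g'S gg'].
by apply: ue; rewrite // eqxx [g == _]eq_sym (negPf gg').
Qed.

(** Induction on a path from [g] to [g'] with next vertex [g1]: insert [p] as the sum of the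
    [u h1 g1] between the factors. If [h1] is adjacent to [h], it is not connected to [h'] either
    and induction applies; otherwise [u h g * u h1 g1] is already zero. *)
Lemma respects_connect1 e e' h h' g g' :
  respects S T u e e' -> h \in T -> h' \in T -> g \in S -> g' \in S ->
  connect (restr S e) g g' -> ~~ connect (restr T e') h h' ->
  u h g * u h' g' = 0.
Proof.
move=> uee; have [up ur uc ue] := uP.
move=> + h'T + + /connectP[s]; elim: s h g => [|g1 s IHs] h g hT gS g'S /=.
  move=> _ -> hh'; apply: ue => //; rewrite eqxx.
  by apply: contraNneq hh' => /esym/eqP ->; apply: connect0.
move=> /andP[/and3P[_ g1S gg1] sP] g'E hh'.
have [_ up_r] := up h g hT gS.
rewrite -[u h g]up_r -(uc g1 g1S) mulr_sumr mulr_suml.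
rewrite big1// => h1 h1T.
have [hh1|hh1] := boolP (e' h h1).
  rewrite -mulrA (IHs h1 g1)// ?mulr0//; apply: contra hh'.
  by apply: connect_trans; apply: connect1; rewrite /restr /= hT h1T.
by rewrite (uee h h1 g g1)// ?mul0r// gg1 (negPf hh1).
Qed.

End Bijection.

Lemma respects_connect (V W : finType) p (S : {set V}) (T : {set W}) u e e' :
  quantum_bij p S T u -> respects S T u e e' ->
  respects S T u (connect (restr S e)) (connect (restr T e')).
Proof.
move=> uP ue h h' g g' hT h'T gS g'S.
case: (boolP (connect _ g g')) => cg;
  case: (boolP (connect _ h h')) => ch //= _.
  exact: (respects_connect1 uP ue).
exact: (respects_connect1 (quantum_bij_tr uP) (respects_tr ue)).
Qed.

(** * Blocks of a quantum bijection along equivalence classes *)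

Section Blocks.
Variables (V W : finType) (p : X) (S : {set V}) (T : {set W}).
Variable u : W -> V -> X.
Variables (r : rel V) (r' : rel W).
Hypotheses (uP : quantum_bij p S T u) (ur : respects S T u r r').
Hypotheses (rE : equivalence_rel r) (rE' : equivalence_rel r').
Hypotheses (rS : rclosed r S) (rT : rclosed r' T).

(** Both sides equal the double sum of [u h g' * u h' g] over the two classes: expand [p] as the sum
    of column [g], respectively of row [h], and the terms outside the classes vanish. *)
Lemma block_sumE : {in T & S, forall h g,
  \sum_(g' in cls r g) u h g' = \sum_(h' in cls r' h) u h' g}.
Proof.
move=> h g hT gS; have [up urow ucol _] := uP.
have gP g' : g' \in cls r g -> g' \in S by rewrite mem_cls; apply: rS.
have hP h' : h' \in cls r' h -> h' \in T by rewrite mem_cls; apply: rT.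
transitivity (\sum_(g' in cls r g) \sum_(h' in cls r' h) u h g' * u h' g).
  apply: eq_bigr => g' g'g; rewrite -mulr_sumr.
  have [_ up_r] := up h g' hT (gP _ g'g); rewrite -[LHS]up_r.
  rewrite -(ucol g gS) !mulr_sumr [LHS](bigID [in cls r' h])/=.
  rewrite [X in _ + X]big1 ?addr0 => [|h' /andP[h'T h'h]].
    apply: eq_bigl => h'; rewrite andb_idl// => /hP//.
  apply: ur => //; first exact: gP.
  move: g'g h'h; rewrite !mem_cls => g'g /negPf ->.
  by rewrite (equivalence_sym rE) g'g.
rewrite exchange_big/=; apply: eq_bigr => h' h'h; rewrite -mulr_suml.
have [up_l _] := up h' g (hP _ h'h) gS; rewrite -[RHS]up_l.
rewrite -(urow h hT) !mulr_suml [RHS](bigID [in cls r g])/=.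
rewrite [X in _ + X]big1 ?addr0 => [|g' /andP[g'S g'g]].
  by apply: eq_bigl => g'; rewrite andb_idl// => /gP.
apply: ur => //; first exact: hP.
move: h'h g'g; rewrite !mem_cls => -> /negPf.
by rewrite (equivalence_sym rE) => ->.
Qed.

(** By row orthogonality only the square of [u h g] survives. Hence a nonzero entry forces a nonzero
    block sum. *)
Lemma block_mulr h g : h \in T -> g \in S ->
  u h g * (\sum_(g' in cls r g) u h g') = u h g.
Proof.
move=> hT gS; have [_ _ _ ue] := uP.
have gg : g \in cls r g by rewrite mem_cls; have [] := rE g g g.
rewrite mulr_sumr (bigD1 g)//= (quantum_bij_idem uP)// big1 ?addr0//.
move=> g' /andP[g'g g'Dg]; apply: ue => //; last first.
  by rewrite eqxx [g == _]eq_sym (negPf g'Dg).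
by apply: (rS gS); rewrite -mem_cls.
Qed.

Lemma block_mull h g : h \in T -> g \in S ->
  (\sum_(g' in cls r g) u h g') * u h g = u h g.
Proof.
move=> hT gS; have [_ _ _ ue] := uP.
have gg : g \in cls r g by rewrite mem_cls; have [] := rE g g g.
rewrite mulr_suml (bigD1 g)//= (quantum_bij_idem uP)// big1 ?addr0//.
move=> g' /andP[g'g g'Dg]; apply: ue => //; last by rewrite eqxx (negPf g'Dg).
by apply: (rS gS); rewrite -mem_cls.
Qed.

Lemma block_quantum_bij h g : h \in T -> g \in S ->
  quantum_bij (\sum_(g' in cls r g) u h g') (cls r g) (cls r' h) u.
Proof.
move=> hT gS; have [_ _ _ ue] := uP.
have gP g' : g' \in cls r g -> g' \in S by rewrite mem_cls; apply: rS.
have hP h' : h' \in cls r' h -> h' \in T by rewrite mem_cls; apply: rT.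
(* In [block_sumE] the left side depends on [g] only through its class, the right side on [h] only
   through its class; so the sum is constant on the block. *)
have sumE h' g' : h' \in cls r' h -> g' \in cls r g ->
    \sum_(g' in cls r g) u h g' = \sum_(g'' in cls r g') u h' g''.
  move=> hh' gg'; have h'T := hP _ hh'; rewrite !mem_cls in hh' gg'.
  by rewrite block_sumE// (eq_cls rE' hh') -block_sumE// (eq_cls rE gg').
split.
- move=> h' g' h'h g'g; rewrite (sumE _ _ h'h g'g).
  by rewrite block_mull ?block_mulr ?gP ?hP.
- move=> h' h'h.
  have gg : g \in cls r g by rewrite mem_cls; have [] := rE g g g.
  by rewrite (sumE _ _ h'h gg).
- move=> g' g'g.
  have hh : h \in cls r' h by rewrite mem_cls; have [] := rE' h h h.
  by rewrite (sumE _ _ hh g'g) block_sumE ?gP.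
- apply: respectsS ue; apply/subsetP => x; [exact: gP|exact: hP].
Qed.

End Blocks.

Hypothesis X_torsion_free : forall (x : X) n, x *+ n.+1 = 0 -> x = 0.

Lemma mulrn_inj_tf (x : X) m n : x != 0 -> x *+ m = x *+ n -> m = n.
Proof.
move=> x0; wlog mn : m n / (m <= n)%N => [wl|].
  by case: (leqP m n) => [/wl//|/ltnW/wl h /esym/h].
move=> /eqP; rewrite -{1}(subnK mn) mulrnDr -subr_eq0 -opprB addrK oppr_eq0.
have: (n <= m)%N -> m = n by move=> nm; apply/eqP; rewrite eqn_leq mn.
rewrite -subn_eq0; case: (n - m)%N => [->//|k _ /eqP/X_torsion_free x0'].
by rewrite x0' eqxx in x0.
Qed.

(** Double counting: on [S'] and [T'] the partial row and column sums are already full, so the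
    entries there add up to both [p *+ #|S'|] and [p *+ #|T'|]. *)
Lemma card_quantum_bij (V W : finType) p (S S' : {set V}) (T T' : {set W}) u :
  p != 0 -> quantum_bij p S T u -> S' \subset S -> T' \subset T ->
  {in T & S, forall h g, u h g != 0 -> (g \in S') = (h \in T')} ->
  #|S'| = #|T'|.
Proof.
move=> p0 [_ ur uc _] /subsetP sS /subsetP sT E.
apply: (mulrn_inj_tf p0).
rewrite -!sumr_const.
transitivity (\sum_(g in S') \sum_(h in T') u h g).
  apply: eq_bigr => g gS'; rewrite -(uc g (sS _ gS')).
  rewrite [LHS](bigID [in T'])/= [X in _ + X]big1 ?addr0 => [|h /andP[hT hT']].
    by apply: eq_bigl => h; rewrite andb_idl// => /sT.
  by apply/eqP; apply: contraNT hT' => /E <-//; apply: sS.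
rewrite exchange_big/=; apply: eq_bigr => h hT'; rewrite -(ur h (sT _ hT')).
rewrite [RHS](bigID [in S'])/=.
rewrite [X in _ = _ + X]big1 ?addr0 => [|g /andP[gS gS']].
  by apply: eq_bigl => g; rewrite andb_idl// => /sS.
by apply/eqP; apply: contraNT gS' => /E ->//; apply: sT.
Qed.

(** * Connected components of induced subgraphs *)

Section Components.
Variables (V : finType) (S : {set V}) (e : rel V).

Lemma restr_sym : symmetric e -> symmetric (restr S e).
Proof. by move=> es x y; rewrite /restr/= es andbCA. Qed.

Lemma connect_restr_equiv :
  symmetric e -> equivalence_rel (connect (restr S e)).
Proof.
move=> es; apply/equivalence_relP; split; first exact: connect0.
exact/same_connect/sym_connect_sym/restr_sym.
Qed.

Lemma closed_connect_cut (A : {set V}) :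
  symmetric e -> {in S :&: A & S :\: A, forall x y, ~~ e x y} ->
  forall x y, x \in A -> connect (restr S e) x y -> y \in A.
Proof.
move=> es cut x y xA /(@closed_connect _ (restr S e) (mem A)) => <- //.
apply: (intro_closed (sym_connect_sym (restr_sym es))) => {x xA}y x.
move=> /and3P[yS xS eyx] yA; apply: contraLR eyx => xA.
by apply: cut; rewrite inE ?yS ?xS ?xA.
Qed.

Lemma rclosed_connect_restr : rclosed (connect (restr S e)) S.
Proof.
move=> x y xS /connectP[s sP ->]; elim: s x xS sP => //= z s IHs x _.
by move=> /andP[/and3P[_ zS _]]; apply: IHs.
Qed.

End Components.

(** A nonzero [u h g] gives a nonzero block unit, so the components of [g] and [h] are isomorphic by
    assumption. Thus [u] is supported on pairs of equal type, and [card_quantum_bij] provides the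
    counts that [set_iso_glue] requires. *)
Lemma set_iso_components (V W : finType) p (S : {set V}) (T : {set W}) u e e' :
  symmetric e -> symmetric e' -> W -> p != 0 -> quantum_bij p S T u ->
  respects S T u e e' ->
  (forall g h q, g \in S -> h \in T -> q != 0 ->
     quantum_bij q (cls (connect (restr S e)) g)
       (cls (connect (restr T e')) h) u ->
     set_iso e e' (cls (connect (restr S e)) g)
       (cls (connect (restr T e')) h)) ->
  set_iso e e' S T.
Proof.
move=> es es' w p0 uP ue IH.
have uc := respects_connect uP ue.
have rE := connect_restr_equiv S es; have rE' := connect_restr_equiv T es'.
have rS := @rclosed_connect_restr _ S e.
have rT := @rclosed_connect_restr _ T e'.
set r := connect (restr S e) in IH uc rE rS.
set r' := connect (restr T e') in IH uc rE' rT.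
have conn : {in T & S, forall h g, u h g != 0 ->
    set_iso e e' (cls r g) (cls r' h)}.
  move=> h g hT gS u0.
  apply: (IH g h (\sum_(g' in cls r g) u h g')) => //.
    apply: contraNneq u0 => q0.
    by rewrite -(block_mulr uP rE rS hT gS) q0 mulr0.
  exact: (block_quantum_bij uP uc).
apply: (@set_iso_glue _ _ e r e' r' w) => //.
- by move=> x y xS yS exy; apply: connect1; rewrite /restr/= xS yS.
- by move=> x y xS yS exy; apply: connect1; rewrite /restr/= xS yS.
- by apply: (card_quantum_bij p0 uP) => // h g hT gS _; rewrite hT gS.
move=> x; apply: (card_quantum_bij p0 uP).
- by apply/subsetP => y; rewrite inE => /andP[].
- by apply/subsetP => y; rewrite inE => /andP[].
move=> h g hT gS /(conn _ _ hT gS) gh; rewrite !inE hT gS/=.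
apply/asboolP/asboolP => xg; first exact: set_iso_trans xg gh.
exact: set_iso_trans xg (set_iso_sym g gh).
Qed.

(** For [b = false] the set [A] disconnects the subgraph on [S], for [b = true] its complement. *)
Definition homogeneous_cut (V : finType) (e : rel V) (S A : {set V}) b :=
  [/\ S :&: A != set0, S :\: A != set0
    & {in S :&: A & S :\: A, forall x y, e x y = b}].

(** The structure of cographs that drives the induction. Quantifying over all [S] lets components
    inherit it. *)
Definition totally_decomposable (V : finType) (e : rel V) :=
  forall S : {set V}, (1 < #|S|)%N -> exists A b, homogeneous_cut e S A b.

Lemma set_iso_quantum_bij (V W : finType) p (S : {set V}) (T : {set W}) u
    (e : rel V) (e' : rel W) :
  symmetric e -> irreflexive e -> symmetric e' -> irreflexive e' -> W ->
  totally_decomposable e -> p != 0 ->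
  quantum_bij p S T u -> respects S T u e e' -> set_iso e e' S T.
Proof.
move=> es ei es' ei' w dec.
have [n] := ubnP #|S|; elim: n p S T => // n IHn p S T; rewrite ltnS => Sn.
move=> p0 uP ue; have [_ _ _ uq] := uP.
have ST : #|S| = #|T|.
  by apply: (card_quantum_bij p0 uP) => // h g hT gS _; rewrite hT gS.
have [S1|S1] := leqP #|S| 1.
  have [S0|[x xS]] := set_0Vmem S.
    have T0 : T = set0.
      by apply/eqP; rewrite -cards_eq0 -ST S0 cards0.
    exists (fun=> w); rewrite S0 T0 imset0; split=> //.
    - by move=> x y; rewrite inE.
    - by move=> x y; rewrite inE.
  have Sx : S = [set x].
    by apply/esym/eqP; rewrite eqEcard sub1set xS cards1.
  have /eqP/cards1P[z Tz] : #|T| = 1%N by rewrite -ST Sx cards1.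
  exists (fun=> z); rewrite Sx Tz; split.
  - by move=> y y' /set1P -> /set1P ->.
  - by rewrite imset_set1.
  - by move=> y y' /set1P -> /set1P ->; rewrite ei ei'.
(* Serves both for the graphs and for their complements: the induction hypothesis speaks of [e] and
   [e'], and [iso1] carries it over to [e1] and [e1']. *)
have step e1 e1' (A : {set V}) : symmetric e1 -> symmetric e1' ->
    respects S T u e1 e1' ->
    (forall K L, set_iso e e' K L -> set_iso e1 e1' K L) ->
    homogeneous_cut e1 S A false -> set_iso e1 e1' S T.
  move=> e1s e1s' ue1 iso1.
  move=> [/set0Pn[a /setIP[aS aA]] /set0Pn[b /setDP[bS bA]] cut].
  have cutN : {in S :&: A & S :\: A, forall x y, ~~ e1 x y}.
    by move=> x y xA yA; rewrite cut.
  apply: (set_iso_components e1s e1s' w p0 uP ue1) => g h q gS hT q0 qP.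
  have rS := @rclosed_connect_restr _ S e1.
  have rT := @rclosed_connect_restr _ T e1'.
  have subS : cls (connect (restr S e1)) g \subset S.
    by apply/subsetP => x; rewrite mem_cls; apply: rS.
  have subT : cls (connect (restr T e1')) h \subset T.
    by apply/subsetP => x; rewrite mem_cls; apply: rT.
  apply/iso1/(IHn q) => //; last exact: respectsS ue.
  apply: leq_trans Sn; apply/proper_card; rewrite properE subS/=.
  have cs := sym_connect_sym (restr_sym S e1s).
  have cutA := closed_connect_cut e1s cutN.
  (* A component stays on one side of the cut, so it misses [b] or [a] and is strictly smaller than
     [S]. *)
  apply/subsetPn; have [gA|gA] := boolP (g \in A).
    exists b => //; rewrite mem_cls; apply: contra bA; exact: cutA.
  exists a => //; rewrite mem_cls cs; apply: contra gA; exact: cutA.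
have [A [[] cut]] := dec S S1; last exact: step ue _ cut.
(* A cut with all edges present has none in the complement, so [step] applies to [cpl e] and
   [cpl e']. *)
apply: (eq_set_iso (cplK ei) (cplK ei')); apply: set_iso_cpl.
apply: (step _ _ A) => //;
  [exact: cpl_sym|exact: cpl_sym|exact: respects_cpl| |].
  by move=> K L; exact: set_iso_cpl.
case: cut => SA SDA cut; split=> // x y xA yA.
by rewrite /cpl cut//= andbF.
Qed.

End QuantumPermutations.

(** * The complex numbers as a C*-algebra *)

Lemma real_cauchy_cvg (R : realType) (u : nat -> R) :
  (forall e, 0 < e -> exists N, forall m n, (N <= m)%N -> (N <= n)%N ->
     `|u m - u n| < e) ->
  exists l, forall e, 0 < e -> exists N, forall n, (N <= n)%N -> `|u n - l| < e.
Proof.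
move=> uC; have : cauchy (u @ \oo)%classic.
  apply/cauchy_ballP => e e0; have [N uN] := uC e e0.
  exists (u @` [set n | (N <= n)%N], u @` [set n | (N <= n)%N])%classic => /=.
    by split; exists N => // n /= Nn; exists n.
  by move=> [_ _] [[m Nm <-] [n Nn <-]]; exact: uN.
move=> /cauchy_cvgP/cvg_ex[l /cvgrPdist_lt ul]; exists l => e /ul[N _ uN].
by exists N => n /uN; rewrite distrC.
Qed.

Section ComplexCstar.
Variable R : realType.
Local Notation C := (R[i]^o).

Lemma normc_Re_le (x : R[i]) : `|complex.Re x| <= Normc.normc x.
Proof.
case: x => a b; rewrite /Normc.normc /= -sqrtr_sqr ler_sqrt ?lerDl ?sqr_ge0//.
by rewrite addr_ge0 ?sqr_ge0.
Qed.

Lemma normc_Im_le (x : R[i]) : `|complex.Im x| <= Normc.normc x.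
Proof.
case: x => a b; rewrite /Normc.normc /= -sqrtr_sqr ler_sqrt ?lerDr ?sqr_ge0//.
by rewrite addr_ge0 ?sqr_ge0.
Qed.

Lemma normc_le_ReIm (x : R[i]) :
  Normc.normc x <= `|complex.Re x| + `|complex.Im x|.
Proof.
case: x => a b; rewrite /Normc.normc /= -[leRHS]ger0_norm ?addr_ge0//.
rewrite -sqrtr_sqr ler_sqrt ?sqr_ge0// sqrrD !real_normK ?num_real//.
by rewrite lerD2r lerDl mulrn_wge0 ?mulr_ge0.
Qed.

(** Real and imaginary parts converge separately, each to within [e / 2]. *)
Lemma complex_cauchy_cvg (u : nat -> C) :
  (forall e : R, 0 < e -> exists N, forall m n, (N <= m)%N -> (N <= n)%N ->
     Normc.normc (u m - u n) < e) ->
  exists l : C, forall e : R, 0 < e -> exists N, forall n, (N <= n)%N ->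
     Normc.normc (u n - l) < e.
Proof.
move=> uC.
have [e e0|a ua] := @real_cauchy_cvg R (fun n => complex.Re (u n : R[i])).
  have [N uN] := uC e e0; exists N => m n Nm Nn; rewrite -raddfB.
  exact: le_lt_trans (normc_Re_le _) (uN m n Nm Nn).
have [e e0|b ub] := @real_cauchy_cvg R (fun n => complex.Im (u n : R[i])).
  have [N uN] := uC e e0; exists N => m n Nm Nn; rewrite -raddfB.
  exact: le_lt_trans (normc_Im_le _) (uN m n Nm Nn).
exists (a +i* b)%C => e e0.
have [N uN] := ua (e / 2) (divr_gt0 e0 (ltr0Sn R 1)).
have [M uM] := ub (e / 2) (divr_gt0 e0 (ltr0Sn R 1)).
exists (maxn N M) => n; rewrite geq_max => /andP[Nn Mn].
apply: le_lt_trans (normc_le_ReIm _) _; rewrite !raddfB/= [e]splitr.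
exact: ltrD (uN n Nn) (uM n Mn).
Qed.

Let conjD : {morph (@Num.conj R[i] : C -> C) : x y / x + y}.
Proof. by move=> x y; rewrite rmorphD. Qed.

Let conjZ (a : R[i]) (x : C) : (a *: x : R[i])^* = a^* *: (x^* : C) :> C.
Proof. by rewrite rmorphM. Qed.

Let conjM (x y : C) : (x * y : R[i])^* = y^* * x^* :> C.
Proof. by rewrite rmorphM mulrC. Qed.

Let normcZ (a : R[i]) (x : C) :
  Normc.normc (a *: x : R[i]) = Normc.normc a * Normc.normc x.
Proof. exact: Normc.normcM. Qed.

Let ler_normcM (x y : C) :
  Normc.normc (x * y : R[i]) <= Normc.normc x * Normc.normc y.
Proof. by rewrite Normc.normcM. Qed.

Let normc_conj_mul (x : C) : Normc.normc (x^* * x : R[i]) = Normc.normc x ^+ 2.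
Proof.
rewrite Normc.normcM expr2; congr (_ * _).
by case: x => a b; rewrite /Normc.normc /= sqrrN.
Qed.

HB.instance Definition _ := Algebra_isCstar.Build R C
  (@conjCK R[i]) conjD conjZ conjM (@Normc.eq0_normc R) (@le_normcD R) normcZ
  ler_normcM complex_cauchy_cvg normc_conj_mul.

End ComplexCstar.

(** * From isomorphisms to quantum isomorphisms *)

Lemma graph_isomorphic_quantum_isomorphic (R : realType) (G H : sgraph) :
  graph_isomorphic G H -> quantum_isomorphic R G H.
Proof.
move=> [f fbij fE]; have GH : #|G| = #|H| := bij_eq_card fbij.
split=> //; have [f' fK f'K] := fbij.
have ef (i : 'I_#|H|) (j : 'I_#|G|) :
    (f (enum_val j) == enum_val i) = (j == enum_rank (f' (enum_val i))).
  by rewrite -{1}[enum_val i]f'K (can_eq fK) (can2_eq enum_valK enum_rankK).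
have ef' (i : 'I_#|H|) (j : 'I_#|G|) :
    (f (enum_val j) == enum_val i) = (i == enum_rank (f (enum_val j))).
  by rewrite eq_sym (can2_eq enum_valK enum_rankK).
have sum_pick (n : nat) (k : 'I_n) (F : 'I_n -> R[i]^o) :
    \sum_j (j == k)%:R * F j = F k.
  rewrite (bigD1 k)//= eqxx mul1r big1 ?addr0// => j /negPf ->.
  by rewrite mul0r.
exists (R[i]^o : cstarAlgType R).
(* The permutation matrix of [f], with scalar entries. *)
exists (\matrix_(i, j) (f (enum_val j) == enum_val i)%:R); split.
  split=> //.
  - move=> i j; rewrite mxE; split; first exact: rmorph_nat.
    by case: (_ == _); rewrite ?mulr1 ?mulr0.
  - move=> i; under eq_bigr => j _ do rewrite mxE ef -[_%:R]mulr1.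
    by rewrite (sum_pick _ _ (fun=> 1)).
  - move=> j; under eq_bigr => i _ do rewrite mxE ef' -[_%:R]mulr1.
    by rewrite (sum_pick _ _ (fun=> 1)).
apply/matrixP => i j; rewrite !mxE.
under eq_bigr => k _ do rewrite !mxE ef.
rewrite sum_pick.
under eq_bigr => k _ do rewrite !mxE ef' mulrC.
(* It remains to compare the pair [f' (enum_val i)], [enum_val j] in [G] with its image under [f] in
   [H]. *)
by rewrite sum_pick !enum_rankK -{2}[enum_val i]f'K fE.
Qed.

(** * Homogeneous cuts in cographs *)

Lemma homogeneous_cut_imset (V W : finType) (e : rel V) (e' : rel W)
    (f : V -> W) (S A : {set V}) b :
  injective f -> {mono f : x y / e x y >-> e' x y} ->
  homogeneous_cut e S A b -> homogeneous_cut e' (f @: S) (f @: A) b.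
Proof.
move=> fi fe [SA SDA cut].
have fI : f @: S :&: f @: A = f @: (S :&: A).
  by rewrite imsetI// => x y _ _; apply: fi.
have fD : f @: S :\: f @: A = f @: (S :\: A).
  apply/setP => w; rewrite !inE; apply/andP/imsetP => [[wA /imsetP[x xS wE]]|].
    exists x; rewrite // inE xS andbT; apply: contra wA => xA.
    by rewrite wE imset_f.
  by move=> [x /setDP[xS xA] ->]; rewrite !(mem_imset _ _ fi) xS xA.
rewrite /homogeneous_cut fI fD !imset_eq0; split=> // v w.
by move=> /imsetP[x xA ->] /imsetP[y yA ->]; rewrite fe cut.
Qed.

(** Induction on the construction. In a disjoint union, a set meeting several summands is cut along
    one of them, with no edges across; a set inside one summand inherits a cut from it.
    Complementation negates [b]. *)
Lemma cograph_totally_decomposable (G : sgraph) :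
  cograph G -> totally_decomposable (@edge G).
Proof.
elim=> {G} [G H [f fb fe] _ IH S S1||I F I0 _ IH S S1|G _ IH S S1].
- have [g fK gK] := fb.
  have gi := can_inj gK; have fi := can_inj fK.
  have [|A [b cut]] := IH (g @: S); first by rewrite card_imset.
  exists (f @: A), b.
  have -> : S = f @: (g @: S).
    by rewrite -imset_comp -[LHS]imset_id; apply: eq_imset => x /=; rewrite gK.
  exact: homogeneous_cut_imset cut.
- move=> S; rewrite ltnNge => /negP[].
  by rewrite -card_unit; apply: max_card.
- have [u uS] : exists u, u \in S by apply/card_gt0P; apply: leq_trans S1.
  pose A := [set v : {i : I & F i} | tag v == tag u].
  have [SA|SA] := eqVneq (S :\: A) set0; last first.
    exists A, false; split=> //.
      by apply/set0Pn; exists u; rewrite !inE uS/=.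
    move=> x y /setIP[_ +] /setDP[_]; rewrite !inE => /eqP xu yu.
    rewrite /edge/= /dunion_edge; case: (eqVneq (tag x) (tag y)) => //= xy.
    by rewrite -xy xu eqxx in yu.
  pose f (x : F (tag u)) : {i : I & F i} := Tagged (fun i => F i) x.
  have fi : injective f.
    by move=> x y /(congr1 (tagged_as (f x))); rewrite !tagged_asE.
  have fe : {mono f : x y / edge x y >-> @edge (dunion F I0) x y}.
    by move=> x y; rewrite /edge/= /dunion_edge/= eqxx tagged_asE.
  have Sf : S = f @: (f @^-1: S).
    apply/setP => v; apply/idP/imsetP => [vS|[x]]; last by rewrite inE => ? ->.
    have /subsetP/(_ _ vS) : S \subset A by rewrite -setD_eq0 SA.
    rewrite inE; case: v vS => j y vS /= /eqP ju.
    move: y vS; rewrite ju => y vS.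
    by exists y; rewrite ?inE.
  have [|B [b cut]] := IH (tag u) (f @^-1: S).
    by rewrite -(card_imset _ fi) -Sf.
  by exists (f @: B), b; rewrite Sf; exact: homogeneous_cut_imset cut.
- have [A [b [SA SDA cut]]] := IH S S1.
  exists A, (~~ b); split=> // x y xA yA.
  (* Opposite sides of the cut hold distinct vertices, so the complement simply negates the edge. *)
  rewrite {1}/edge/= /compl_edge cut// andb_idl// => _.
  apply: contraTneq xA => ->; move: yA; rewrite !inE => /andP[/negPf -> _].
  by rewrite andbF.
Qed.

(** Orthogonality in rows and columns comes from [projections_orthogonal]; compatibility with edges
    comes from the intertwining equation, entry by entry. *)
Lemma quantum_isomorphic_quantum_bij (R : realType) (G H : sgraph) :
  quantum_isomorphic R G H -> exists (X : cstarAlgType R) (u : H -> G -> X),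
    quantum_bij 1 [set: G] [set: H] u /\
    respects [set: G] [set: H] u (@edge G) (@edge H).
Proof.
move=> [_ [X [U [[_ UP Urow Ucol] UE]]]].
exists X, (fun h g => U (enum_rank h) (enum_rank g)).
have row0 i j k : j != k -> U i j * U i k = 0.
  by apply: (projections_orthogonal (p := U i)).
have col0 i j k : i != j -> U i k * U j k = 0.
  by apply: (projections_orthogonal (p := fun i => U i k)).
split; first split.
- by move=> h g _ _; rewrite mul1r mulr1.
- move=> h _; rewrite -(Urow (enum_rank h)).
  rewrite [RHS](reindex enum_rank) /=; last exact/onW_bij/enum_rank_bij.
  by apply: eq_bigl => k; rewrite inE.
- move=> g _; rewrite -(Ucol (enum_rank g)).
  rewrite [RHS](reindex enum_rank) /=; last exact/onW_bij/enum_rank_bij.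
  by apply: eq_bigl => k; rewrite inE.
- move=> h h' g g' _ _ _ _.
  have [<-|hh'] := eqVneq h h'; have [<-|gg'] := eqVneq g g' => //= _.
    by apply: row0; rewrite (inj_eq enum_rank_inj).
  by apply: col0; rewrite (inj_eq enum_rank_inj).
move=> h h' g g' _ _ _ _ ne.
set i := enum_rank h; set i' := enum_rank h'.
set j := enum_rank g; set j' := enum_rank g'.
have pp k l : U k l * U k l = U k l by case: (UP k l).
(* Sandwiching entry [(i, j')] between [U i j] and [U i' j'] keeps only [k = j] on the left and
   [k = i'] on the right. So [U i j * U i' j'], weighted by the adjacency of [g] and [g'], equals
   itself weighted by that of [h] and [h']. *)
have := congr1 (fun M : 'M[X]_(_, _) => U i j * M i j' * U i' j') UE.
rewrite !mxE !mulr_sumr !mulr_suml.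
rewrite (bigD1 j)//= [X in _ + X]big1 ?addr0; last first.
  by move=> k kj; rewrite !mulrA row0 ?mul0r// eq_sym.
rewrite [RHS](bigD1 i')//= [X in _ = _ + X]big1 ?addr0; last first.
  by move=> k ki'; rewrite -!mulrA (col0 _ _ _ ki') !mulr0.
rewrite !mxE !enum_rankK mulrA pp -!mulrA pp.
move: ne; case: edge; case: edge => // _; rewrite ?mul1r ?mul0r ?mulr0// => ->.
Qed.

Theorem theorem4p7 (R : realType) (G H : sgraph) :
  cograph G -> cograph H ->
  (graph_isomorphic G H <-> quantum_isomorphic R G H).
Proof.
move=> cG _; split; first exact: graph_isomorphic_quantum_isomorphic.
move=> /quantum_isomorphic_quantum_bij[X [u [uP ue]]].
have /card_gt0P[w _] := vertex_gt0 H.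
(* The scalars have characteristic zero. *)
have tf (x : X) n : x *+ n.+1 = 0 -> x = 0.
  by move=> /eqP; rewrite -scaler_nat scaler_eq0 pnatr_eq0/= => /eqP.
have [f [fi fT fe]] := set_iso_quantum_bij tf (@edge_sym G) (@edge_irr G)
  (@edge_sym H) (@edge_irr H) w (cograph_totally_decomposable cG)
  (oner_neq0 X) uP ue.
exists f; last by move=> x y; rewrite fe ?inE.
apply: inj_card_bij; first by move=> x y; apply: fi; rewrite inE.
by rewrite -!cardsT -fT leq_imset_card.
Qed.
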